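(* Let $e\geq 2$ be an integer and let $O(2e+1,e,e+1)$ be the doubled Odd graph. Then $\mu(O(2e+1,e,e+1))\leq 2e+1$.
   Context: For a connected graph $\Gamma$ with distance function $d$, a resolving set is a set of vertices $S=\{v_1,\ldots,v_k\}$ such that for any two distinct vertices $u,v$ the vectors $(d(u,v_1),\ldots,d(u,v_k))$ and $(d(v,v_1),\ldots,d(v,v_k))$ differ. The metric dimension $\mu(\Gamma)$ is the smallest size of a resolving set of $\Gamma$. The doubled Odd graph $O(2e+1,e,e+1)$ is the bipartite graph whose vertex set is the union of the set of $e$-element subsets and the set of $(e+1)$-element subsets of $\{1,\ldots,2e+1\}$, where an $e$-subset $P$ and an $(e+1)$-subset $Q$ are adjacent iff $P\subseteq Q$ (and there are no other edges). *)

(* Defs.v *)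
From mathcomp Require Import all_boot.

Set Implicit Arguments.
Unset Strict Implicit.
Unset Printing Implicit Defensive.

Section MetricDimension.

Variables (T : finType) (e : rel T).

Definition walk (k : nat) (x y : T) : bool :=
  [exists p : k.-tuple T, path e x p && (last x p == y)].

(* A shortest walk has length < #|T|, so the bounded search is exhaustive when
   y is reachable from x (gdist_min); otherwise the value is #|T|. *)
Definition gdist (x y : T) : nat := find (fun k => walk k x y) (iota 0 #|T|).

Definition resolving (S : {set T}) : bool :=
  [forall u, forall v, (u != v) ==> [exists w in S, gdist u w != gdist v w]].

(* [set: T] is always resolving (resolvingT), so this is a genuine minimum. *)
Definition metric_dim : nat := #|[arg min_(S < [set: T] | resolving S) #|S| ]|.

Lemma walkP k x y :
  reflect (exists p : seq T, [/\ size p = k, path e x p & last x p = y])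
          (walk k x y).
Proof.
apply: (iffP existsP) => [[p /andP[pp /eqP lp]]|[p [sp pp lp]]].
  by exists p; rewrite size_tuple.
by move/eqP: sp => sp; exists (Tuple sp); rewrite /= pp lp eqxx.
Qed.

Lemma gdist_min x y : connect e x y ->
  walk (gdist x y) x y /\ (forall k, walk k x y -> gdist x y <= k).
Proof.
move=> /connectP[p0 pp0 ->].
case/shortenP: pp0 => p pp up _; set y0 := last x p.
have ltp : size p < #|T|.
  have -> : (size p).+1 = size (x :: p) by [].
  by rewrite -(card_uniqP up) max_card.
have wp : walk (size p) x y0 by apply/walkP; exists p.
have hs : has (fun k => walk k x y0) (iota 0 #|T|).
  by apply/hasP; exists (size p); rewrite // mem_iota.
have lt : gdist x y0 < #|T| by rewrite -[#|T|](size_iota 0) -has_find.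
split=> [|k wk]; first by have := nth_find 0 hs; rewrite nth_iota.
rewrite leqNgt; apply/negP=> ltk.
have := before_find 0 ltk.
by rewrite nth_iota ?add0n ?wk // (ltn_trans ltk).
Qed.

Lemma gdistxx x : gdist x x = 0.
Proof.
have [_ /(_ 0)] := gdist_min (connect0 e x).
by rewrite leqn0 => H; apply/eqP/H/walkP; exists [::].
Qed.

Lemma gdist_gt0 x y : x != y -> 0 < gdist x y.
Proof.
move=> xy; rewrite /gdist; have : 0 < #|T| by apply/card_gt0P; exists x.
case: #|T| => //= n _; case: walkP => // -[p [/size0nil -> _ /= xy']].
by rewrite xy' eqxx in xy.
Qed.

Lemma resolvingT : resolving [set: T].
Proof.
apply/forallP=> u; apply/forallP=> v; apply/implyP=> uv.
apply/existsP; exists u; rewrite inE gdistxx /= eq_sym -lt0n.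
by apply: gdist_gt0; rewrite eq_sym.
Qed.

Lemma metric_dimP :
  (exists2 S : {set T}, resolving S & #|S| = metric_dim)
  /\ (forall S : {set T}, resolving S -> metric_dim <= #|S|).
Proof.
rewrite /metric_dim; case: arg_minnP; first exact: resolvingT.
by move=> S rS minS; split=> //; exists S.
Qed.

End MetricDimension.

Section DoubledOdd.

Variable e : nat.

Definition dodd_vertex : finType :=
  {A : {set 'I_(2 * e + 1)} | (#|A| == e) || (#|A| == e.+1)}.

Definition dodd_adj : rel dodd_vertex := fun P Q =>
  [&& #|val P| == e, #|val Q| == e.+1 & val P \subset val Q]
  || [&& #|val Q| == e, #|val P| == e.+1 & val Q \subset val P].

Lemma dodd_adj_sym : symmetric dodd_adj.
Proof. by move=> P Q; rewrite /dodd_adj orbC. Qed.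

Lemma dodd_connected P Q : connect dodd_adj P Q.
Proof.
pose mkv (A : {set 'I_(2 * e + 1)}) (vA : (#|A| == e) || (#|A| == e.+1)) : dodd_vertex :=
  exist (fun A : {set 'I_(2 * e + 1)} => (#|A| == e) || (#|A| == e.+1)) A vA.
have csym := sym_connect_sym dodd_adj_sym.
have low P1 : exists2 P2 : dodd_vertex, #|val P2| = e & connect dodd_adj P1 P2.
  case/orP: (valP P1) => /eqP cP; first by exists P1.
  have /card_gt0P[x xP] : 0 < #|val P1| by rewrite cP.
  have cP' : #|val P1 :\ x| = e by move: cP; rewrite (cardsD1 x) xP => -[].
  have vP : (#|val P1 :\ x| == e) || (#|val P1 :\ x| == e.+1) by rewrite cP' eqxx.
  exists (mkv _ vP); rewrite //= csym; apply: connect1.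
  by rewrite /dodd_adj /= cP cP' !eqxx subD1set.
have [P' cP /connect_trans-> //] := low P; have [Q' cQ] := low Q.
rewrite csym => /(connect_trans _)-> //.
move En: #|val P' :\: val Q'| => n; elim: n P' cP En => [|n IH] P1 cP En.
  have -> : P1 = Q'; last exact: connect0.
  apply/val_inj/eqP; rewrite eqEcard cP cQ leqnn andbT.
  by rewrite -setD_eq0 -cards_eq0 En.
have /card_gt0P[y] : 0 < #|val P1 :\: val Q'| by rewrite En.
have /card_gt0P[x] : 0 < #|val Q' :\: val P1|.
  by move: En; rewrite !cardsD setIC cQ cP => ->.
rewrite !inE => /andP[xP xQ] /andP[yQ yP].
have cA : #|x |: val P1| = e.+1 by rewrite cardsU1 xP cP.
have cB : #|x |: (val P1 :\ y)| = e.
  by move: cP; rewrite cardsU1 !inE (negPf xP) andbF (cardsD1 y) yP.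
have vA : (#|x |: val P1| == e) || (#|x |: val P1| == e.+1).
  by rewrite cA eqxx orbT.
have vB : (#|x |: (val P1 :\ y)| == e) || (#|x |: (val P1 :\ y)| == e.+1).
  by rewrite cB eqxx.
apply: (@connect_trans _ _ (mkv _ vA)).
  by apply: connect1; rewrite /dodd_adj /= cA cP !eqxx subsetUr.
apply: (@connect_trans _ _ (mkv _ vB)).
  apply: connect1; apply/orP; right.
  by rewrite /= cA cB !eqxx setUS ?subD1set.
apply: IH => //=.
have -> : (x |: (val P1 :\ y)) :\: val Q' = (val P1 :\: val Q') :\ y.
  apply/setP=> z; rewrite !inE; case: (eqVneq z x) => [->|_] /=.
    by rewrite xQ !andbF.
  by rewrite andbCA.
by move: En; rewrite (cardsD1 y) !inE yQ yP => -[].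
Qed.

End DoubledOdd.

(* Main.v *)
Require Import Defs.
From mathcomp Require Import all_boot zify.

(** The doubled Odd graph sits isometrically in the hypercube: the distance of
    two vertices is the size of their symmetric difference. Hence if two
    vertices [w], [w'] differ exactly in the element [j], the distances of [X]
    to [w] and to [w'] tell whether [j] belongs to [X]. The 2e+1 intervals
    [[k/2, e + (k+1)/2)], k = 0 .. 2e, form a path in the graph that toggles
    each element except 2e exactly once, so the distances to them determine
    [X] up to the element 2e, and the distance to the first one then
    determines whether 2e belongs to [X]. *)

Set Implicit Arguments.
Unset Strict Implicit.
Unset Printing Implicit Defensive.

Section SymmetricDifference.

Variable T : finType.
Implicit Types (A B X Y : {set T}) (j : T).

(** The cardinality of the symmetric difference, as a sum of bits so that the contribution of one
    element can be split off. *)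
Definition symdist A B : nat := \sum_i ((i \in A) (+) (i \in B)).

Lemma symdistC A B : symdist A B = symdist B A.
Proof. by apply: eq_bigr => i _; rewrite addbC. Qed.

Lemma symdist_eq0 A B : symdist A B = 0 -> A = B.
Proof.
move/eqP; rewrite sum_nat_eq0 => /forallP H; apply/setP => i.
by have := H i; rewrite /=; case: (i \in A); case: (i \in B).
Qed.

Lemma symdistxx A : symdist A A = 0.
Proof. by rewrite /symdist big1 // => i _; rewrite addbb. Qed.

Definition toggled j A B :=
  j \in B = (j \notin A) /\ forall i, i != j -> (i \in B) = (i \in A).

Lemma toggled_setU1 j A : j \notin A -> toggled j A (j |: A).
Proof. by move=> jA; split=> [|i /negPf ij]; rewrite !inE ?eqxx ?jA ?ij. Qed.

Lemma toggled_setD1 j A : j \in A -> toggled j A (A :\ j).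
Proof. by move=> jA; split=> [|i ij]; rewrite !inE ?eqxx ?jA ?ij. Qed.

(** Only the bit at [j] changes, and it is negated; adding the old bit on one side and the new one
    on the other avoids truncated subtraction. *)
Lemma symdist_toggled j A B X : toggled j A B ->
  symdist B X + ((j \in A) (+) (j \in X)) =
  symdist A X + ~~ ((j \in A) (+) (j \in X)).
Proof.
case=> jB eqB; rewrite /symdist !(bigD1 (P := xpredT) j) //= jB addNb.
rewrite (eq_bigr (fun i => (i \in A) (+) (i \in X) : nat)); first by lia.
by move=> i /eqB->.
Qed.

Lemma mem_eq_of_toggled j A B X Y : toggled j A B ->
    symdist A X = symdist A Y -> symdist B X = symdist B Y ->
  (j \in X) = (j \in Y).
Proof.
move=> tAB dA dB; move: (symdist_toggled X tAB) (symdist_toggled Y tAB).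
by rewrite dA dB; case: (j \in A); case: (j \in X); case: (j \in Y) => //=; lia.
Qed.

Lemma eq_of_symdist j A X Y : (forall i, i != j -> (i \in X) = (i \in Y)) ->
  symdist A X = symdist A Y -> X = Y.
Proof.
move=> eqXY; rewrite /symdist !(bigD1 (P := xpredT) j) //=.
rewrite (eq_bigr (fun i => (i \in A) (+) (i \in Y) : nat)); last first.
  by move=> i /eqXY->.
move=> /eqP; rewrite eqn_add2r => /eqP dj; apply/setP => i.
have [->|/eqXY //] := eqVneq i j.
by move: dj; case: (j \in A); case: (j \in X); case: (j \in Y).
Qed.

End SymmetricDifference.

Section DoubledOddDistance.

Variable e : nat.
Implicit Types P Q : dodd_vertex e.

(** An edge toggles a single element. Iterated along a walk, this bounds the graph distance from
    below. *)
Lemma symdist_adj P P' Q : dodd_adj P P' ->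
  symdist (val P) (val Q) <= (symdist (val P') (val Q)).+1.
Proof.
move=> adj; suff [j /(symdist_toggled (val Q))] :
    exists j, toggled j (val P) (val P').
  by case: (_ (+) _) => /=; lia.
have sub (A B : {set 'I_(2 * e + 1)}) : #|A| = e -> #|B| = e.+1 ->
    A \subset B -> exists2 j, j \notin A & B = j |: A.
  move=> cA cB sAB; have /cards1P[j Ej] : #|B :\: A| == 1.
    by rewrite cardsD (setIidPr sAB) cA cB subSnn.
  have : j \in B :\: A by rewrite Ej set11.
  rewrite inE => /andP[jA _]; exists j => //.
  by rewrite -Ej -{1}(setID B A) (setIidPr sAB) setUC.
case/orP: adj => /and3P[/eqP c1 /eqP c2 /(sub _ _ c1 c2)[j jA Ej]]; exists j.
  by rewrite Ej; apply: toggled_setU1.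
rewrite Ej -{2}(setU1K jA); apply: toggled_setD1; exact: setU11.
Qed.

(** An [e]-set other than [Q] misses an element of [Q], which can be added; an [(e+1)]-set other
    than [Q] has an element outside [Q], which can be removed. Both follow by comparing
    cardinalities. *)
Lemma closer_neighbour P Q : P != Q ->
  exists2 P', dodd_adj P P' &
    symdist (val P) (val Q) = (symdist (val P') (val Q)).+1.
Proof.
move=> neqPQ; case/orP: (valP P) => /eqP cP.
- have /card_gt0P[x] : 0 < #|val Q :\: val P|.
    rewrite card_gt0 setD_eq0; apply: contra neqPQ => sQP.
    rewrite eq_sym -val_eqE eqEcard sQP cP.
    by case/orP: (valP Q) => /eqP->; rewrite ?leqnn ?leqnSn.
  rewrite inE => /andP[xP xQ].
  have cA : #|x |: val P| = e.+1 by rewrite cardsU1 xP cP.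
  have vA : (#|x |: val P| == e) || (#|x |: val P| == e.+1).
    by rewrite cA eqxx orbT.
  exists (Sub (x |: val P) vA).
    by rewrite /dodd_adj /= cA cP !eqxx subsetUr.
  have := symdist_toggled (val Q) (toggled_setU1 xP).
  by rewrite SubK xQ (negPf xP) /=; lia.
- have /card_gt0P[x] : 0 < #|val P :\: val Q|.
    rewrite card_gt0 setD_eq0; apply: contra neqPQ => sPQ.
    rewrite -val_eqE eqEcard sPQ cP.
    by case/orP: (valP Q) => /eqP->; rewrite ?leqnn ?leqnSn.
  rewrite inE => /andP[xQ xP].
  have cA : #|val P :\ x| = e by move: cP; rewrite (cardsD1 x) xP => -[].
  have vA : (#|val P :\ x| == e) || (#|val P :\ x| == e.+1) by rewrite cA eqxx.
  exists (Sub (val P :\ x) vA).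
    by rewrite /dodd_adj /= cA cP !eqxx subsetDl orbT.
  have := symdist_toggled (val Q) (toggled_setD1 xP).
  by rewrite SubK (negPf xQ) xP /=; lia.
Qed.

Lemma gdist_dodd P Q : gdist (@dodd_adj e) P Q = symdist (val P) (val Q).
Proof.
have [/walkP[p [sp pp lp]] min] := gdist_min (dodd_connected P Q).
apply/eqP; rewrite eqn_leq; apply/andP; split.
  (* Repeated moves to a closer neighbour form a walk of length [symdist]. *)
  apply: min; move En: (symdist _ _) => n {p sp pp lp}.
  elim: n P En => [|n IH] P En.
    by apply/walkP; exists [::]; split=> //; apply/val_inj/symdist_eq0.
  have /closer_neighbour[P' adj] : P != Q.
    by apply/eqP => PQ; move: En; rewrite PQ symdistxx.
  rewrite En => -[/esym/IH/walkP[p [sp pp lp]]].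
  by apply/walkP; exists (P' :: p); rewrite /= sp adj.
rewrite -sp; elim: p P pp lp {sp min} => [|P' p IH] P /=.
  by move=> _ ->; rewrite symdistxx.
move=> /andP[adj pp] lp; apply: leq_trans (symdist_adj Q adj) _.
exact: IH.
Qed.

End DoubledOddDistance.

Section SlidingIntervals.

Variable e : nat.

Definition sliding k : {set 'I_(2 * e + 1)} :=
  [set i : 'I_(2 * e + 1) | k./2 <= i < e + uphalf k].

Lemma card_sliding k : k <= 2 * e -> #|sliding k| = e + odd k.
Proof.
move=> ke; rewrite cardsE cardE size_filter /=.
rewrite -(count_map val (fun i => k./2 <= i < e + uphalf k)) -enumT val_enum_ord.
(* The indices are cut into those before, in and after the interval; [k <= 2 * e] keeps its right
   end within range. *)
have -> : 2 * e + 1 = k./2 + ((e + odd k) + (2 * e + 1 - (e + uphalf k))).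
  by rewrite uphalf_half; lia.
rewrite iotaD count_cat iotaD count_cat add0n.
rewrite (@eq_in_count _ _ pred0 (iota 0 _)); last first.
  by move=> i; rewrite mem_iota /=; lia.
rewrite (@eq_in_count _ _ predT (iota k./2 _)); last first.
  by move=> i; rewrite mem_iota uphalf_half /=; lia.
rewrite (@eq_in_count _ _ pred0 (iota (k./2 + _) _)); last first.
  by move=> i; rewrite mem_iota uphalf_half /=; lia.
by rewrite !count_pred0 count_predT size_iota addn0.
Qed.

Lemma sliding_vertex (k : 'I_(2 * e + 1)) :
  (#|sliding k| == e) || (#|sliding k| == e.+1).
Proof.
by rewrite card_sliding; [case: odd; lia | have := ltn_ord k; lia].
Qed.

Definition sliding_path (k : 'I_(2 * e + 1)) : dodd_vertex e :=
  Sub (sliding k) (sliding_vertex k).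

Lemma sliding_toggled (i : 'I_(2 * e + 1)) : i < 2 * e ->
  exists2 k, k < 2 * e & toggled i (sliding k) (sliding k.+1).
Proof.
move=> lti; have [ltie|leei] := ltnP i e.
  (* An odd step removes the left end [k./2], here [i]. *)
  exists (i.*2.+1); first by lia.
  split=> [|j]; rewrite !inE /= ?uphalf_double ?doubleK.
    by lia.
  by rewrite -val_eqE /=; lia.
(* An even step appends [e + k./2] on the right, here [i]. *)
exists (i - e).*2; first by lia.
split=> [|j]; rewrite !inE /= ?uphalf_double ?doubleK.
  by lia.
by rewrite -val_eqE /=; lia.
Qed.

Lemma resolving_sliding :
  resolving (@dodd_adj e) [set sliding_path k | k in 'I_(2 * e + 1)].
Proof.
apply/forallP => X; apply/forallP => Y; apply/implyP.
apply: contraR => /existsPn same; apply/eqP/val_inj.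
have dist k : k <= 2 * e ->
    symdist (sliding k) (val X) = symdist (sliding k) (val Y).
  move=> ke; have ltk : k < 2 * e + 1 by rewrite addn1.
  have := same (sliding_path (Ordinal ltk)).
  rewrite imset_f //= negbK !gdist_dodd => /eqP.
  by rewrite !(symdistC _ (val (sliding_path _))).
have lte : 2 * e < 2 * e + 1 by rewrite addn1.
(* The last right end is [2 * e], exclusive, so the element [2 * e] is never toggled and is settled
   by one distance alone. *)
apply: (@eq_of_symdist _ (Ordinal lte) (sliding 0)); last exact: dist.
move=> i; rewrite -val_eqE /= => ie.
have /sliding_toggled[k ltk tog] : i < 2 * e by have := ltn_ord i; lia.
by apply: mem_eq_of_toggled tog _ _; apply: dist; lia.
Qed.

End SlidingIntervals.

Theorem theorem3p1 (e : nat) (he : 2 <= e) :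
  metric_dim (@dodd_adj e) <= 2 * e + 1.
Proof.
have [_ /(_ _ (resolving_sliding e)) le] := metric_dimP (@dodd_adj e).
by apply: leq_trans le (leq_trans (leq_imset_card _ _) _); rewrite card_ord.
Qed.
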